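(* Let $\gamma_0:=\frac12-\frac{\log 2}{\log 5}$. Let $p\geq5$ be a prime, let $n,R\geq1$ be integers, and write $R=\gamma n$ with $\gamma<\gamma_0$. Let $A$ be a random $R\times n$ matrix over $\mathbb{F}_p$ whose columns are chosen independently, each column being equal to any given vector of $\mathbb{F}_p^R$ with probability $p^{-R}$. Then the probability that $A$ is non-degenerate is at least $1-p^{-(\gamma_0-\gamma)n}$.
   Context: An $R\times n$ matrix $A$ is called non-degenerate if $\operatorname{rank}A'=R$ for every submatrix $A'$ of $A$ formed by all $R$ rows and by $\lceil n/2\rceil$ of the columns of $A$. *)

(* Defs.v *)
From HB Require Import structures.
From mathcomp Require Import all_boot all_order all_algebra.
From mathcomp Require Import all_classical all_reals all_analysis.

Set Implicit Arguments.
Unset Strict Implicit.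
Unset Printing Implicit Defensive.

Import Order.TTheory GRing.Theory Num.Theory.

Local Open Scope classical_set_scope.
Local Open Scope ring_scope.

Definition gamma0 (R : realType) : R := 2^-1 - ln 2 / ln 5.

(* [uphalf n] is the ceiling of n / 2; [enum_val] lists the elements of the
   column set J in increasing order. *)
Definition nondegenerate_mx (F : fieldType) (r n : nat) (A : 'M[F]_(r, n)) : Prop :=
  forall J : {set 'I_n}, #|J| = uphalf n ->
    \rank (colsub (fun k : 'I_#|J| => enum_val k) A) = r.

(* Measurability for the discrete sigma-algebra on a finite type V: since V is
   finite, measurability of the fibres gives that of all preimages. *)
Definition discrete_rv (d : measure_display) (T : measurableType d)
    (V : finType) (X : T -> V) : Prop :=
  forall v : V, measurable (X @^-1` [set v]).

Definition mutually_independent (d : measure_display) (T : measurableType d)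
    (R : realType) (P : probability T R) (I V : finType) (X : I -> T -> V) : Prop :=
  forall (J : {set I}) (B : I -> set V),
    P (\bigcap_(i in [set` J]) X i @^-1` B i) =
    (\prod_(i in J) P (X i @^-1` B i))%E.

(* Main.v *)
(** If A is degenerate, some nonzero row vector u annihilates uphalf n columns
    of A. For fixed u and fixed columns this has probability p^-(uphalf n),
    because each column lies in the hyperplane orthogonal to u with probability
    1/p. A union bound over at most 2^n column sets and p^r vectors u bounds the
    failure probability by 2^n p^(r - n/2), and 2 <= p^(ln 2 / ln 5) as p >= 5. *)

Require Import Defs.
From HB Require Import structures.
From mathcomp Require Import all_boot all_order all_algebra mxabelem.
From mathcomp Require Import all_classical all_reals all_analysis.
From mathcomp Require Import ring lra.

Set Implicit Arguments.
Unset Strict Implicit.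
Unset Printing Implicit Defensive.

Import Order.TTheory GRing.Theory Num.Theory.

Local Open Scope classical_set_scope.
Local Open Scope ring_scope.

(** After transposition the annihilated vectors form the row kernel of [u^T], a subspace of
    dimension [r - 1] because a nonzero row has rank 1. *)
Lemma card_annihilator (F : finFieldType) (r : nat) (u : 'rV[F]_r) :
  u != 0 -> #|[set v : 'cV[F]_r | u *m v == 0]%SET| = (#|F| ^ r.-1)%N.
Proof.
move=> u0.
have -> : [set v : 'cV[F]_r | u *m v == 0]%SET = trmx @^-1: rowg (kermx u^T).
  apply/setP => v; rewrite !inE sub_kermx -trmx_mul.
  by rewrite -(inj_eq (can_inj (@trmxK F 1 1))) trmx0.
rewrite on_card_preimset; last first.
  by exists trmx => v _; rewrite trmxK.
by rewrite card_rowg mxrank_ker mxrank_tr rank_rV u0 subn1.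
Qed.

(** Rank [r] means independent rows, that is, a zero left kernel; [u] is a nonzero vector of that
    kernel, tested column by column. *)
Lemma not_nondegenerate_mxP (F : fieldType) (r n : nat) (A : 'M[F]_(r, n)) :
  ~ nondegenerate_mx A <->
  exists J : {set 'I_n}, exists u : 'rV[F]_r,
    [/\ #|J| = uphalf n, u != 0 & forall j, j \in J -> u *m col j A = 0].
Proof.
split=> [/existsNP[J /not_implyP[cJ]]|[J [u [cJ u0 uA]]] ndA].
  move/eqP; rewrite -[_ == _]/(row_free _) -kermx_eq0 => /rowV0Pn[u /sub_kermxP uA u0].
  exists J, u; split=> // j jJ.
  have /matrixP uAj := uA; apply/matrixP => a b; rewrite !mxE.
  (* Column [j] of [A] sits in the submatrix at the rank of [j] in the enumeration of [J]. *)
  have := uAj a (enum_rank_in jJ j); rewrite !mxE => {2}<-.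
  by apply: eq_bigr => k _; rewrite !mxE enum_rankK_in.
have /eqP := ndA J cJ; rewrite -[_ == _]/(row_free _) -kermx_eq0 => /eqP k0.
move/negP: u0; apply; rewrite -submx0 -k0 sub_kermx.
apply/eqP/matrixP => a k; have /matrixP/(_ a 0) := uA _ (enum_valP k).
by rewrite !mxE => {2}<-; apply: eq_bigr => i _; rewrite !mxE.
Qed.

Lemma content_fin_union_bound (d : measure_display) (T : ringOfSetsType d)
    (R : realType) (mu : {content set T -> \bar R}) (I : finType)
    (D : {set I}) (E : I -> set T) (c : R) :
  (forall i, i \in D -> measurable (E i)) ->
  (forall i, i \in D -> (mu (E i) <= c%:E)%E) ->
  (mu (\bigcup_(i in [set` D]) E i) <= (#|D|%:R * c)%:E)%E.
Proof.
move=> mE le_c.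
have mU : measurable (\bigcup_(i in [set` D]) E i).
  exact: fin_bigcup_measurable.
apply: (le_trans (content_sub_fsum mu (D := [set` D]) finite_finset mE mU (@subset_refl _ _))).
have -> : [set` D] = [set` enum D].
  by apply/seteqP; split=> i /=; rewrite mem_enum.
rewrite -fsbig_seq ?enum_uniq // big_enum /=.
apply: le_trans (lee_sum _ le_c) _.
by rewrite sumEFin sumr_const mulr_natl.
Qed.

Section RandomColumns.
Context (R : realType) (F : finFieldType) (n r : nat).
Context (d : measure_display) (T : measurableType d) (P : probability T R).
Variable A : T -> 'M[F]_(r, n).
Hypothesis A_rv : forall j : 'I_n, discrete_rv (fun w => col j (A w)).
Hypothesis A_indep : mutually_independent P (fun (j : 'I_n) w => col j (A w)).
Hypothesis A_unif : forall (j : 'I_n) (v : 'cV[F]_r),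
  P [set w | col j (A w) = v] = ((#|F|%:R : R) ^- r)%:E.

Let q : R := #|F|%:R.
Let q_gt0 : 0 < q.
Proof. by rewrite ltr0n; apply/card_gt0P; exists 0. Qed.

(** Splitting the event over the finitely many values of the column reduces its measurability to
    [A_rv] and its probability to [A_unif]. *)
Let col_annihilated (j : 'I_n) (u : 'rV[F]_r) :
  [set w | u *m col j (A w) = 0] =
  \bigcup_(v in [set` [set v : 'cV[F]_r | u *m v == 0]%SET])
    [set w | col j (A w) = v].
Proof.
apply/seteqP; split=> w /=.
  by move=> uA; exists (col j (A w)) => //=; rewrite inE uA.
by move=> [v] /=; rewrite inE => /eqP uv ->.
Qed.

Lemma measurable_col_annihilated j (u : 'rV[F]_r) :
  measurable [set w | u *m col j (A w) = 0].
Proof.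
rewrite col_annihilated; apply: fin_bigcup_measurable => // v _.
exact: A_rv.
Qed.

Lemma prob_col_annihilated j (u : 'rV[F]_r) : u != 0 ->
  (P [set w | u *m col j (A w) = 0]%R <= q^-1%:E)%E.
Proof.
move=> u0; rewrite col_annihilated.
apply: le_trans (content_fin_union_bound (c := q ^- r) _ _) _.
- by move=> v _; exact: A_rv.
- by move=> v _; have /eqP := A_unif j v; rewrite eq_le => /andP[].
rewrite card_annihilator // lee_fin natrX -/q.
(* For [r = 0] the truncated [r.-1] would give the wrong count, but then no nonzero [u] exists. *)
case: r u u0 => [|k] u u0; first by rewrite (thinmx0 u) eqxx in u0.
by rewrite exprS invfM mulrCA mulfV ?mulr1 // expf_neq0 // gt_eqF.
Qed.

Definition cols_annihilated (J : {set 'I_n}) (u : 'rV[F]_r) : set T :=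
  \bigcap_(j in [set` J]) [set w | u *m col j (A w) = 0].

Lemma measurable_cols_annihilated J u : measurable (cols_annihilated J u).
Proof.
apply: fin_bigcap_measurable => // j _; exact: measurable_col_annihilated.
Qed.

Lemma prob_cols_annihilated J (u : 'rV[F]_r) : u != 0 ->
  (P (cols_annihilated J u) <= (q ^- #|J|)%:E)%E.
Proof.
move=> u0; have := A_indep J (fun=> [set v | u *m v = 0]).
rewrite /cols_annihilated => ->.
rewrite -exprVn -prodr_const -prodEFin.
(* Products of extended reals are monotone only for nonnegative factors, so the induction carries
   nonnegativity along with the bound. *)
pose dom (a b : \bar R) := (0 <= a <= b)%E.
suff /andP[] : dom (\prod_(j in J) P [set w | u *m col j (A w) = 0%R])%E
  (\prod_(j in J) q^-1%:E)%E by [].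
apply: (big_ind2 dom) => [|a b a' b' /andP[a0 ab] /andP[a'0 a'b']|j _].
- by rewrite /dom lee01 lexx.
- by rewrite /dom mule_ge0 // lee_pmul.
- by rewrite /dom measure_ge0 prob_col_annihilated.
Qed.

Let bad : {set {set 'I_n} * 'rV[F]_r} :=
  [set Ju : {set 'I_n} * 'rV[F]_r | (#|Ju.1| == uphalf n) && (Ju.2 != 0)]%SET.

Let nondegenerateE : [set w | nondegenerate_mx (A w)] =
  ~` \bigcup_(Ju in [set` bad]) cols_annihilated Ju.1 Ju.2.
Proof.
apply/seteqP; split=> w /=.
  move=> ndA [[J u]] /=; rewrite inE /= => /andP[/eqP cJ u0] uA.
  by apply: (not_nondegenerate_mxP (A w)).2 ndA; exists J, u.
move=> nbad; apply: contrapT => /not_nondegenerate_mxP[J [u [cJ u0 uA]]].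
by apply: nbad; exists (J, u) => //=; rewrite inE /= cJ eqxx.
Qed.

Lemma prob_nondegenerate_ge :
  ((1 - 2 ^+ n * q ^+ r * q ^- uphalf n)%:E
    <= P [set w | nondegenerate_mx (A w)])%E.
Proof.
rewrite nondegenerateE probability_setC; last first.
  by apply: fin_bigcup_measurable => // Ju _; exact: measurable_cols_annihilated.
rewrite EFinB; apply: leeB => //.
apply: le_trans (content_fin_union_bound (c := q ^- uphalf n) _ _) _.
- by move=> Ju _; exact: measurable_cols_annihilated.
- by move=> [J u]; rewrite inE /= => /andP[/eqP <- u0]; exact: prob_cols_annihilated.
rewrite lee_fin ler_wpM2r // ?invr_ge0 ?exprn_ge0 ?(ltW q_gt0) //.
(* The bad pairs are counted crudely among all pairs: [2 ^ n] column sets times [q ^ r] row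
   vectors. *)
rewrite /q -!natrX -natrM ler_nat (leq_trans (max_card _)) //.
by rewrite card_prod card_mx mul1n -cardsT -powersetT card_powerset cardsT card_ord.
Qed.

End RandomColumns.

(** Taking logarithms leaves [ln 5 <= ln x]. Equality at [x = 5] explains the constant in
    [gamma0]. *)
Lemma powR_ln2_ln5_ge2 (R : realType) (x : R) : 5 <= x -> 2 <= x `^ (ln 2 / ln 5).
Proof.
move=> x5; have ln5 : 0 < ln 5 :> R by rewrite ln_gt0 // ltr1n.
have x0 : 0 < x by lra.
rewrite -ler_ln ?posrE ?powR_gt0 //= ln_powR mulrAC.
by rewrite ler_pdivlMr // ler_wpM2l ?ln_ge0 ?ler1n // ler_ln ?posrE.
Qed.

Lemma union_bound_exponent (R : realType) (x gamma : R) (n r : nat) :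
  5 <= x -> r%:R = gamma * n%:R ->
  2 ^+ n * x ^+ r * x ^- uphalf n <= x `^ (- ((gamma0 R - gamma) * n%:R)).
Proof.
move=> x5 rE; have x0 : 0 < x by lra.
(* The three summands match the three factors on the left: choice of columns, choice of [u], and
   annihilation probability. *)
have -> : - ((gamma0 R - gamma) * n%:R) =
    ln 2 / ln 5 * n%:R + r%:R + - (2^-1 * n%:R).
  by rewrite rE /gamma0; ring.
have powD a b : x `^ (a + b) = x `^ a * x `^ b by rewrite powRD // (gt_eqF x0) implybT.
rewrite !powD powRrM !powR_mulrn ?powR_ge0 ?(ltW x0) //.
apply: ler_pM.
- by rewrite mulr_ge0 ?exprn_ge0 // ltW.
- by rewrite invr_ge0 exprn_ge0 // ltW.
- rewrite ler_wpM2r ?exprn_ge0 ?(ltW x0) //.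
  by apply: lerXn2r; rewrite ?nnegrE ?powR_ge0 // powR_ln2_ln5_ge2.
(* Rounding up works in the right direction: [n / 2 <= uphalf n], and powers of [x >= 1] increase
   with the exponent. *)
rewrite powRN lef_pV2 ?posrE ?powR_gt0 ?exprn_gt0 //.
rewrite -powR_mulrn ?(ltW x0) //; apply: ler_powR; first lra.
by rewrite ler_pdivrMl // -natrM ler_nat mul2n -leq_uphalf_double.
Qed.

Theorem claim2 (R : realType) (p : nat) (p_prime : prime p) (p_ge5 : (5 <= p)%N)
    (n r : nat) (n_ge1 : (1 <= n)%N) (r_ge1 : (1 <= r)%N)
    (gamma : R) (r_eq : r%:R = gamma * n%:R) (gamma_lt : gamma < gamma0 R)
    (d : measure_display) (T : measurableType d) (P : probability T R)
    (A : T -> 'M['F_p]_(r, n))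
    (A_rv : forall j : 'I_n, discrete_rv (fun w : T => col j (A w)))
    (A_indep : mutually_independent P (fun (j : 'I_n) (w : T) => col j (A w)))
    (A_unif : forall (j : 'I_n) (v : 'cV['F_p]_r),
       P [set w : T | col j (A w) = v] = ((p%:R : R) ^- r)%:E) :
  ((1 - (p%:R : R) `^ (- ((gamma0 R - gamma) * n%:R)))%:E
     <= P [set w : T | nondegenerate_mx (A w)])%E.
Proof.
have A_unif' j v : P [set w | col j (A w) = v] = ((#|'F_p|%:R : R) ^- r)%:E.
  by rewrite card_Fp.
apply: le_trans (prob_nondegenerate_ge A_rv A_indep A_unif').
rewrite card_Fp // lee_fin lerB //; apply: union_bound_exponent => //.
by rewrite (ler_nat _ 5).
Qed.
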